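(* Let $\Sigma,\Delta$ be finite alphabets. If $S$ is a set of marked morphisms from $\Sigma^*$ to $\Delta^*$, then there exist a finite alphabet $\Sigma_S$ and a marked morphism $\psi_S:\Sigma_S^*\to\Sigma^*$ such that $\operatorname{Image}(\psi_S)=\operatorname{Eq}(S)$. Moreover, there exists an algorithm which, given as input a finite set $S$ of marked morphisms from $\Sigma^*$ to $\Delta^*$, outputs such a marked morphism $\psi_S$.
   Context: For a finite alphabet $\Sigma$ (possibly empty), $\Sigma^*$ is the free monoid on $\Sigma$. A monoid morphism $f:\Sigma^*\to\Delta^*$ is marked if $f(a)$ is a non-empty word for every $a\in\Sigma$ and, for distinct $a,b\in\Sigma$, the words $f(a)$ and $f(b)$ start with different letters of $\Delta$. For morphisms $g,h:\Sigma^*\to\Delta^*$ put $\operatorname{Eq}(g,h)=\{x\in\Sigma^*\mid g(x)=h(x)\}$, and for a set $S$ of morphisms $\Sigma^*\to\Delta^*$ put $\operatorname{Eq}(S)=\bigcap_{g,h\in S}\operatorname{Eq}(g,h)$. For algorithmic purposes a morphism $f:\Sigma^*\to\Delta^*$ is given as the list of words $(f(a))_{a\in\Sigma}$. *)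

(* Defs.v *)
From mathcomp Require Import all_boot.
From mathcomp Require Import boolp classical_sets.

Set Implicit Arguments.
Unset Strict Implicit.
Unset Printing Implicit Defensive.

Local Open Scope classical_set_scope.

(* The free monoid on an alphabet A is [seq A], with concatenation and [::]. *)

Definition monoid_morphism (A B : Type) (f : seq A -> seq B) : Prop :=
  f [::] = [::] /\ forall x y, f (x ++ y) = f x ++ f y.

Definition marked (A B : Type) (f : seq A -> seq B) : Prop :=
  [/\ monoid_morphism f,
      forall a, f [:: a] <> [::]
    & forall a b, a <> b -> ohead (f [:: a]) <> ohead (f [:: b])].

Definition Eq (A B : Type) (g h : seq A -> seq B) : set (seq A) :=
  [set x | g x = h x].

(* [EqS set0] is the whole free monoid (empty intersection). *)
Definition EqS (A B : Type) (S : set (seq A -> seq B)) : set (seq A) :=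
  \bigcap_(g in S) \bigcap_(h in S) Eq g h.

(* Model of computation: the WHILE language of N. D. Jones, "Computability and
   Complexity from a Programming Perspective" (MIT Press, 1997), which is
   Turing complete. Data are binary trees; [Leaf] plays the role of nil and
   of the truth value false, every other tree counts as true. *)

Inductive tree : Type := Leaf | Node of tree & tree.

Fixpoint tree_eqb (t u : tree) : bool :=
  match t, u with
  | Leaf, Leaf => true
  | Node t1 t2, Node u1 u2 => tree_eqb t1 u1 && tree_eqb t2 u2
  | _, _ => false
  end.

Inductive expr : Type :=
| Var of nat
| Const of tree
| Cons of expr & expr
| Hd of expr
| Tl of expr
| IsEq of expr & expr.

Inductive cmd : Type :=
| Assign of nat & expr
| Seq of cmd & cmd
| While of expr & cmd.

(* Variable number i holds the i-th entry of the store, and [Leaf] when the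
   store has no such entry. *)
Definition store : Type := seq tree.

Fixpoint eval (e : expr) (s : store) : tree :=
  match e with
  | Var i => nth Leaf s i
  | Const t => t
  | Cons e1 e2 => Node (eval e1 s) (eval e2 s)
  | Hd e1 => if eval e1 s is Node t _ then t else Leaf
  | Tl e1 => if eval e1 s is Node _ t then t else Leaf
  | IsEq e1 e2 =>
      if tree_eqb (eval e1 s) (eval e2 s) then Node Leaf Leaf else Leaf
  end.

Inductive exec : cmd -> store -> store -> Prop :=
| exec_assign i e s : exec (Assign i e) s (set_nth Leaf s i (eval e s))
| exec_seq c1 c2 s1 s2 s3 :
    exec c1 s1 s2 -> exec c2 s2 s3 -> exec (Seq c1 c2) s1 s3
| exec_while_false e c s : eval e s = Leaf -> exec (While e c) s s
| exec_while_true e c s1 s2 s3 :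
    eval e s1 <> Leaf -> exec c s1 s2 -> exec (While e c) s2 s3 ->
    exec (While e c) s1 s3.

(* Started with [input] in variable 0 and [Leaf] in all the others, c halts
   with [output] in variable 0. Execution is deterministic, so there is at most
   one such output. *)
Definition computes (c : cmd) (input output : tree) : Prop :=
  exists2 s : store, exec c [:: input] s & nth Leaf s 0 = output.

Definition encode_seq (T : Type) (enc : T -> tree) (s : seq T) : tree :=
  foldr (fun x t => Node (enc x) t) Leaf s.

(* Unary numerals. *)
Definition encode_nat (n : nat) : tree := iter n (Node Leaf) Leaf.

(* A letter is given by its rank in the enumeration of its alphabet. *)
Definition encode_letter (A : finType) (a : A) : tree :=
  encode_nat (enum_rank a).

Definition encode_word (A : finType) (w : seq A) : tree :=
  encode_seq (@encode_letter A) w.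

(* A morphism is given by the list of the images of the letters. *)
Definition encode_morphism (A B : finType) (f : seq A -> seq B) : tree :=
  encode_seq (@encode_word B) [seq f [:: a] | a <- enum A].

(* A finite set of morphisms is given by any list of its elements. *)
Definition encode_morphisms (A B : finType) (fs : seq (seq A -> seq B)) :
    tree :=
  encode_seq (@encode_morphism A B) fs.

(* Main.v *)
From mathcomp Require Import zify.
Require Import Defs.
From mathcomp Require Import all_boot.
From mathcomp Require Import boolp classical_sets.

(** An equaliser Eq(S) is a submonoid closed under left cancellation, so it is
generated by its atoms, the non-empty elements that are not a product of two
non-empty elements. When all the morphisms of S are marked, two atoms x, y with
the same first letter coincide: let p be their longest common prefix. If f p and
g p differ for some f, g in S, one of them, say f p, is a proper prefix of the
other, and the letter of g p following f p is the first letter of f a where a is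
the next letter of x, and also where a is the next letter of y; as f is marked,
x and y go on with the same letter, which is absurd. So p lies in Eq(S), and
then x = p = y because both are atoms ([synchronised], [atom_head_inj]). Hence
the atoms form a finite set and, having distinct first letters, they are the
letter images of a marked morphism onto Eq(S) ([basis_morphism]).

For the algorithm it is enough to bound the lengths of the atoms by a computable
function: one then enumerates all the words below the bound, keeps the elements
of Eq(S), and among these the irreducible ones.

For two morphisms g, h the bound comes from a descent, the one that makes the
marked Post correspondence problem decidable. A block is a pair (u, v) with
g u = h v that is non-empty and minimal; u is determined by its first letter, so
the blocks, indexed by these letters, define two marked morphisms g', h' into
the words over the original alphabet, and every solution of g x = h x has the
form x = g' y = h' y where y solves the successor equation g' y = h' y. Going to
the successor does not increase the number of proper suffixes of letter images,
because a proper suffix of u is determined by the overhang, a proper suffix of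
an image under h, from which the block has to be completed ([slim_closing]). So
all successors range over a finite set of known size. Atoms correspond to atoms,
and their lengths strictly decrease as long as they are not 1 ([descent]); so no
pair recurs together with the same first letter, the chain of successors is not
longer than the number of possible states, and each step divides the length by a
bounded factor at most ([atom_size_state], [atom_size_pair]).

For a longer list g, f, f1, f2, ... one computes the basis psi of Eq(g, f) and goes
on with the shorter list of the compositions of g, f1, f2, ... with psi
([atom_size_seq]).

Computability of the algorithm is obtained from closure properties: functions
realised by programs working in a fresh part of the store are closed under
composition, pairing, tests and iteration over lists; encoded functions are then
built from typed combinators. *)

Set Implicit Arguments.
Unset Strict Implicit.
Unset Printing Implicit Defensive.

(** * Tree functions computed by WHILE programs *)

Definition hd_tree (t : tree) : tree := if t is Node u _ then u else Leaf.
Definition tl_tree (t : tree) : tree := if t is Node _ u then u else Leaf.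
Definition eq_tree (t u : tree) : tree :=
  if tree_eqb t u then Node Leaf Leaf else Leaf.

Fixpoint fold_tree (g : tree -> tree -> tree) (a l : tree) : tree :=
  if l is Node x l' then fold_tree g (g a x) l' else a.

(** The program is indexed by a register n: it reads its argument from n, writes
its result there, leaves the registers below n alone and assumes nothing about
those above. So subprograms compose without any renaming or cleaning. *)
Definition tree_computable (F : tree -> tree) : Prop :=
  exists c : nat -> cmd, forall n s, exists s',
    [/\ exec (c n) s s', nth Leaf s' n = F (nth Leaf s n)
      & forall i, i < n -> nth Leaf s' i = nth Leaf s i].

Lemma tree_computable_expr (e : nat -> expr) F :
  (forall n s, eval (e n) s = F (nth Leaf s n)) -> tree_computable F.
Proof.
move=> eF; exists (fun n => Assign n (e n)) => n s.
exists (set_nth Leaf s n (eval (e n) s)); split.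
- exact: exec_assign.
- by rewrite nth_set_nth /= eqxx eF.
- by move=> i i_n; rewrite nth_set_nth /= ltn_eqF.
Qed.

Lemma tree_computable_comp F G :
  tree_computable F -> tree_computable G -> tree_computable (fun t => F (G t)).
Proof.
move=> [c cP] [d dP]; exists (fun n => Seq (d n) (c n)) => n s.
have [s1 [e1 v1 k1]] := dP n s; have [s2 [e2 v2 k2]] := cP n s1.
exists s2; split; first exact: exec_seq e1 e2.
- by rewrite v2 v1.
- by move=> i i_n; rewrite k2 ?k1.
Qed.

Lemma tree_computable_id : tree_computable id.
Proof. exact: (@tree_computable_expr Var). Qed.

Lemma tree_computable_const t : tree_computable (fun=> t).
Proof. exact: (@tree_computable_expr (fun=> Const t)). Qed.

Lemma tree_computable_hd : tree_computable hd_tree.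
Proof. exact: (@tree_computable_expr (fun n => Hd (Var n))). Qed.

Lemma tree_computable_tl : tree_computable tl_tree.
Proof. exact: (@tree_computable_expr (fun n => Tl (Var n))). Qed.

Lemma tree_computable_eq : tree_computable (fun t => eq_tree (hd_tree t) (tl_tree t)).
Proof.
exact: (@tree_computable_expr (fun n => IsEq (Hd (Var n)) (Tl (Var n)))).
Qed.

Lemma tree_computable_node F G : tree_computable F -> tree_computable G ->
  tree_computable (fun t => Node (F t) (G t)).
Proof.
move=> [c cP] [d dP].
exists (fun n => Seq (Assign n.+1 (Var n)) (Seq (c n.+1)
  (Seq (Assign n.+2 (Var n)) (Seq (d n.+2)
  (Assign n (Defs.Cons (Var n.+1) (Var n.+2))))))) => n s.
set s1 := set_nth Leaf s n.+1 (nth Leaf s n).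
have [s2 [e2 v2 k2]] := cP n.+1 s1.
set s3 := set_nth Leaf s2 n.+2 (nth Leaf s2 n).
have [s4 [e4 v4 k4]] := dP n.+2 s3.
pose u := Node (nth Leaf s4 n.+1) (nth Leaf s4 n.+2).
have s2n : nth Leaf s2 n = nth Leaf s n.
  by rewrite k2 // /s1 nth_set_nth /= ltn_eqF.
exists (set_nth Leaf s4 n u); split.
- apply: exec_seq (exec_assign _ _ _) _; apply: exec_seq e2 _.
  apply: exec_seq (exec_assign _ _ _) _; apply: exec_seq e4 _.
  exact: exec_assign.
- rewrite nth_set_nth /= eqxx /u v4 k4 // /s3 !nth_set_nth /= eqxx s2n.
  by rewrite ltn_eqF // v2 /s1 nth_set_nth /= eqxx.
- move=> i i_n; rewrite nth_set_nth /= ltn_eqF //.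
  have i2 := leqW i_n; have i3 := leqW i2.
  rewrite k4 // /s3 nth_set_nth /= (ltn_eqF i3) k2 // /s1 nth_set_nth /=.
  by rewrite (ltn_eqF i2).
Qed.

(** The argument is a context, an initial accumulator and a list, paired to the
right; every step of the fold receives the context again. With n holding the
context, n+1 the accumulator and n+2 the rest of the list, the body of the loop
runs the step in register n+3. *)
Lemma tree_computable_fold F : tree_computable F ->
  tree_computable (fun t =>
    fold_tree (fun a x => F (Node (hd_tree t) (Node a x)))
      (hd_tree (tl_tree t)) (tl_tree (tl_tree t))).
Proof.
move=> [c cP].
pose body n := Seq (Assign n.+3
    (Defs.Cons (Var n) (Defs.Cons (Var n.+1) (Hd (Var n.+2)))))
  (Seq (c n.+3) (Seq (Assign n.+1 (Var n.+3)) (Assign n.+2 (Tl (Var n.+2))))).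
have loop n l : forall s, nth Leaf s n.+2 = l -> exists s',
    [/\ exec (While (Var n.+2) (body n)) s s',
        nth Leaf s' n.+1 =
          fold_tree (fun a x => F (Node (nth Leaf s n) (Node a x)))
            (nth Leaf s n.+1) l
      & forall i, i < n -> nth Leaf s' i = nth Leaf s i].
  elim: l => [|x _ l IHl] s sl; first by exists s; split => //; apply: exec_while_false.
  set s1 := set_nth Leaf s n.+3
    (Node (nth Leaf s n) (Node (nth Leaf s n.+1) x)).
  have [s2 [e2 v2 k2]] := cP n.+3 s1.
  set s3 := set_nth Leaf s2 n.+1 (nth Leaf s2 n.+3).
  set s4 := set_nth Leaf s3 n.+2 l.
  have s21 i : i < n.+3 -> nth Leaf s2 i = nth Leaf s i.
    by move=> i_n; rewrite k2 // /s1 nth_set_nth /= (ltn_eqF i_n).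
  have s4l : nth Leaf s4 n.+2 = l by rewrite nth_set_nth /= eqxx.
  have s4a : nth Leaf s4 n.+1 = F (Node (nth Leaf s n) (Node (nth Leaf s n.+1) x)).
    rewrite nth_set_nth /= ltn_eqF // nth_set_nth /= eqxx v2.
    by rewrite /s1 nth_set_nth /= eqxx.
  have s4i i : i <= n -> nth Leaf s4 i = nth Leaf s i.
    move=> i_n; rewrite nth_set_nth /= ltn_eqF ?nth_set_nth /=; last first.
      by rewrite ltnS ltnW.
    by rewrite ltn_eqF ?ltnS // s21 // ltnS; do 2!apply: ltnW.
  have [s' [e' v' k']] := IHl s4 s4l.
  exists s'; split.
  - apply: exec_while_true e'; first by rewrite /= sl.
    have -> : s4 = set_nth Leaf s3 n.+2 (eval (Tl (Var n.+2)) s3).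
      congr set_nth; rewrite /= nth_set_nth /= gtn_eqF // s21 // sl //.
    apply: exec_seq; first exact: exec_assign.
    apply: exec_seq; first by rewrite /= sl; exact: e2.
    by apply: exec_seq; apply: exec_assign.
  - by rewrite v' s4a s4i.
  - by move=> i i_n; rewrite k' // s4i // ltnW.
exists (fun n => Seq (Assign n.+1 (Hd (Tl (Var n)))) (Seq
  (Assign n.+2 (Tl (Tl (Var n)))) (Seq (Assign n (Hd (Var n)))
  (Seq (While (Var n.+2) (body n)) (Assign n (Var n.+1)))))) => n s.
set t := nth Leaf s n.
set s1 := set_nth Leaf s n.+1 (hd_tree (tl_tree t)).
set s2 := set_nth Leaf s1 n.+2 (tl_tree (tl_tree t)).
set s3 := set_nth Leaf s2 n (hd_tree t).
have s1n : nth Leaf s1 n = t by rewrite nth_set_nth /= ltn_eqF.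
have s2n : nth Leaf s2 n = t by rewrite nth_set_nth /= ltn_eqF.
have s3l : nth Leaf s3 n.+2 = tl_tree (tl_tree t).
  by rewrite nth_set_nth /= gtn_eqF // nth_set_nth /= eqxx.
have s3a : nth Leaf s3 n.+1 = hd_tree (tl_tree t).
  rewrite nth_set_nth /= gtn_eqF // nth_set_nth /= ltn_eqF //.
  by rewrite nth_set_nth /= eqxx.
have s3n : nth Leaf s3 n = hd_tree t by rewrite nth_set_nth /= eqxx.
have [s4 [e4 v4 k4]] := loop n _ s3 s3l.
exists (set_nth Leaf s4 n (nth Leaf s4 n.+1)); split.
- apply: exec_seq; first exact: exec_assign.
  apply: exec_seq; first exact: exec_assign.
  rewrite /= -/s1 -/t -/(tl_tree _) -/(tl_tree _) -/(hd_tree _) s1n -/s2.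
  apply: exec_seq; first exact: exec_assign.
  rewrite /= s2n -/s3.
  by apply: exec_seq e4 _; apply: exec_assign.
- by rewrite nth_set_nth /= eqxx v4 s3a s3n.
- move=> i i_n; rewrite nth_set_nth /= ltn_eqF // k4 // /s3 nth_set_nth /=.
  rewrite ltn_eqF // nth_set_nth /= (ltn_eqF (leqW (leqW i_n))).
  by rewrite nth_set_nth /= (ltn_eqF (leqW i_n)).
Qed.

(** * Computable functions between encoded types *)

Definition encode_pair (X Y : Type) (eX : X -> tree) (eY : Y -> tree)
  (p : X * Y) : tree := Node (eX p.1) (eY p.2).

(** Truth values are those returned by [IsEq], and at the same time numerals, so
that a conditional is an iteration. *)
Definition encode_bool (b : bool) : tree := encode_nat b.

Definition computable (X Y : Type) (eX : X -> tree) (eY : Y -> tree)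
    (f : X -> Y) : Prop :=
  exists2 F, tree_computable F & forall x, F (eX x) = eY (f x).

Section Combinators.
Variables (X : Type) (eX : X -> tree).

Lemma computable_const Y (eY : Y -> tree) y : computable eX eY (fun=> y).
Proof. by exists (fun=> eY y) => //; apply: tree_computable_const. Qed.

Lemma computable_id : computable eX eX id.
Proof. by exists id => //; apply: tree_computable_id. Qed.

Lemma computable_comp Y Z (eY : Y -> tree) (eZ : Z -> tree) g f :
  computable eY eZ g -> computable eX eY f -> computable eX eZ (fun x => g (f x)).
Proof.
move=> [G cG GP] [F cF FP]; exists (fun t => G (F t)); last by move=> x; rewrite FP GP.
exact: tree_computable_comp.
Qed.

Lemma computable_pair Y Z (eY : Y -> tree) (eZ : Z -> tree) f g :
  computable eX eY f -> computable eX eZ g ->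
  computable eX (encode_pair eY eZ) (fun x => (f x, g x)).
Proof.
move=> [F cF FP] [G cG GP]; exists (fun t => Node (F t) (G t)).
  exact: tree_computable_node.
by move=> x; rewrite FP GP.
Qed.

Lemma computable_fst Y Z (eY : Y -> tree) (eZ : Z -> tree) (f : X -> Y * Z) :
  computable eX (encode_pair eY eZ) f -> computable eX eY (fun x => (f x).1).
Proof.
move=> [F cF FP]; exists (fun t => hd_tree (F t)); last by move=> x; rewrite FP.
exact: tree_computable_comp tree_computable_hd cF.
Qed.

Lemma computable_snd Y Z (eY : Y -> tree) (eZ : Z -> tree) (f : X -> Y * Z) :
  computable eX (encode_pair eY eZ) f -> computable eX eZ (fun x => (f x).2).
Proof.
move=> [F cF FP]; exists (fun t => tl_tree (F t)); last by move=> x; rewrite FP.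
exact: tree_computable_comp tree_computable_tl cF.
Qed.

Lemma computable_cons Y (eY : Y -> tree) y s :
  computable eX eY y -> computable eX (encode_seq eY) s ->
  computable eX (encode_seq eY) (fun x => y x :: s x).
Proof.
move=> [F cF FP] [G cG GP]; exists (fun t => Node (F t) (G t)).
  exact: tree_computable_node.
by move=> x; rewrite FP GP.
Qed.

Lemma computable_behead Y (eY : Y -> tree) s :
  computable eX (encode_seq eY) s ->
  computable eX (encode_seq eY) (fun x => behead (s x)).
Proof.
move=> [F cF FP]; exists (fun t => tl_tree (F t)).
  exact: tree_computable_comp tree_computable_tl cF.
by move=> x; rewrite FP; case: (s x).
Qed.

Lemma tree_eqbP t u : reflect (t = u) (tree_eqb t u).
Proof.
elim: t u => [|t1 IH1 t2 IH2] [|u1 u2] /=; do ?by constructor.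
apply: (iffP andP) => [[/IH1-> /IH2->]//|[<- <-]].
by split; [apply/IH1 | apply/IH2].
Qed.

Lemma computable_eq (Y : eqType) (eY : Y -> tree) f g : injective eY ->
  computable eX eY f -> computable eX eY g ->
  computable eX encode_bool (fun x => f x == g x).
Proof.
move=> eYI [F cF FP] [G cG GP]; exists (fun t => eq_tree (F t) (G t)).
  exact: tree_computable_comp tree_computable_eq (tree_computable_node cF cG).
move=> x; rewrite FP GP /eq_tree; have [->|fg] := eqVneq (f x) (g x).
  by case: tree_eqbP.
by case: tree_eqbP => // /eYI /eqP; rewrite (negbTE fg).
Qed.

(** The step may depend on the argument x, which is passed along as context: a
function with several arguments is handled as a function of nested pairs. *)
Lemma computable_foldl Y Z (eY : Y -> tree) (eZ : Z -> tree)
    (g : X -> Z -> Y -> Z) z s :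
  computable eX (encode_seq eY) s -> computable eX eZ z ->
  computable (encode_pair eX (encode_pair eZ eY)) eZ
    (fun p => g p.1 p.2.1 p.2.2) ->
  computable eX eZ (fun x => foldl (g x) (z x) (s x)).
Proof.
move=> [S cS SP] [Z0 cZ ZP] [G cG GP].
exists (fun t => fold_tree (fun a x => G (Node t (Node a x))) (Z0 t) (S t)).
  apply: (tree_computable_comp (G := fun t => Node t (Node (Z0 t) (S t)))
    (tree_computable_fold cG)).
  apply: tree_computable_node; first exact: tree_computable_id.
  exact: tree_computable_node.
move=> x; rewrite SP ZP; elim: (s x) (z x) => //= y s' IHs a.
by rewrite -IHs -(GP (x, (a, y))).
Qed.

Lemma computable_iter Y (eY : Y -> tree) (g : X -> Y -> Y) n y :
  computable eX encode_nat n -> computable eX eY y ->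
  computable (encode_pair eX eY) eY (fun p => g p.1 p.2) ->
  computable eX eY (fun x => iter (n x) (g x) (y x)).
Proof.
move=> [N cN NP] [Z0 cZ ZP] [G cG GP].
exists (fun t => fold_tree (fun a _ => G (Node t a)) (Z0 t) (N t)).
  have cG' : tree_computable (fun u => G (Node (hd_tree u) (hd_tree (tl_tree u)))).
    apply: tree_computable_comp cG _.
    apply: tree_computable_node; first exact: tree_computable_hd.
    exact: tree_computable_comp tree_computable_hd tree_computable_tl.
  apply: (tree_computable_comp (G := fun t => Node t (Node (Z0 t) (N t)))
    (tree_computable_fold cG')).
  apply: tree_computable_node; first exact: tree_computable_id.
  exact: tree_computable_node.
move=> x; rewrite NP ZP; elim: (n x) (y x) => //= m IHm a.
by rewrite -iterS iterSr -IHm -(GP (x, a)).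
Qed.

End Combinators.

Section Derived.
Variables (X : Type) (eX : X -> tree).

Lemma computable_weaken Y Z (eY : Y -> tree) (eZ : Z -> tree) f :
  computable eX eZ f -> computable (encode_pair eX eY) eZ (fun p => f p.1).
Proof.
by move=> cf; apply: computable_comp cf _; apply: computable_fst (@computable_id _ _).
Qed.

(** All functions here are total, so a conditional is an iteration with at most
one step, the truth value being the number of steps. *)
Lemma computable_if Y (eY : Y -> tree) (b : X -> bool) f g :
  computable eX encode_bool b -> computable eX eY f -> computable eX eY g ->
  computable eX eY (fun x => if b x then f x else g x).
Proof.
move=> cb cf cg.
have [F cF FP] : computable eX eY (fun x => iter (b x) (fun=> f x) (g x)).
  by apply: (@computable_iter _ _ _ _ (fun x _ => f x)) cb cg _; apply: computable_weaken.
by exists F => // x; rewrite FP; case: (b x).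
Qed.

Lemma computable_and (b c : X -> bool) :
  computable eX encode_bool b -> computable eX encode_bool c ->
  computable eX encode_bool (fun x => b x && c x).
Proof.
by move=> cb cc; apply: computable_if cb cc _; apply: computable_const.
Qed.

Lemma computable_neg (b : X -> bool) : computable eX encode_bool b ->
  computable eX encode_bool (fun x => ~~ b x).
Proof. by move=> cb; apply: computable_if cb _ _; apply: computable_const. Qed.

Lemma computable_succ n : computable eX encode_nat n ->
  computable eX encode_nat (fun x => (n x).+1).
Proof.
move=> [N cN NP]; exists (fun t => Node Leaf (N t)); last by move=> x; rewrite NP.
by apply: tree_computable_node cN; apply: tree_computable_const.
Qed.

End Derived.

Lemma computable_add (X : Type) (eX : X -> tree) (m n : X -> nat) :
  computable eX encode_nat m -> computable eX encode_nat n ->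
  computable eX encode_nat (fun x => m x + n x).
Proof.
move=> cm cn.
have [F cF FP] : computable eX encode_nat (fun x => iter (m x) succn (n x)).
  apply: (@computable_iter _ _ _ _ (fun _ => succn)) => //.
  by apply: computable_succ; apply: computable_snd (@computable_id _ _).
by exists F => // x; rewrite FP iter_succn addnC.
Qed.

Lemma computable_mul (X : Type) (eX : X -> tree) (m n : X -> nat) :
  computable eX encode_nat m -> computable eX encode_nat n ->
  computable eX encode_nat (fun x => m x * n x).
Proof.
move=> cm cn.
have [F cF FP] : computable eX encode_nat (fun x => iter (m x) (addn (n x)) 0).
  apply: (@computable_iter _ _ _ _ (fun x => addn (n x))) => //.
    exact: computable_const.
  apply: computable_add; first exact: computable_weaken.
  exact: computable_snd (@computable_id _ _).
by exists F => // x; rewrite FP iter_addn addn0 mulnC.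
Qed.

Lemma computable_exp (X : Type) (eX : X -> tree) (m n : X -> nat) :
  computable eX encode_nat m -> computable eX encode_nat n ->
  computable eX encode_nat (fun x => m x ^ n x).
Proof.
move=> cm cn.
have [F cF FP] : computable eX encode_nat (fun x => iter (n x) (muln (m x)) 1).
  apply: (@computable_iter _ _ _ _ (fun x => muln (m x))) => //.
    exact: computable_const.
  apply: computable_mul; first exact: computable_weaken.
  exact: computable_snd (@computable_id _ _).
by exists F => // x; rewrite FP iter_muln muln1.
Qed.

Section Sequences.
Variables (X : Type) (eX : X -> tree).

Lemma computable_rev Y (eY : Y -> tree) s :
  computable eX (encode_seq eY) s ->
  computable eX (encode_seq eY) (fun x => rev (s x)).
Proof.
move=> cs.
have [F cF FP] : computable eX (encode_seq eY)
    (fun x => foldl (fun a y => y :: a) [::] (s x)).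
  apply: (@computable_foldl _ _ _ _ eY _ (fun _ a y => y :: a)) => //.
    exact: computable_const.
  have cp := computable_snd
    (@computable_id _ (encode_pair eX (encode_pair (encode_seq eY) eY))).
  by apply: computable_cons; [apply: computable_snd cp | apply: computable_fst cp].
exists F => // x; rewrite FP /rev; congr encode_seq.
by elim: (s x) [::] => //= y l IHl a; rewrite IHl.
Qed.

Lemma computable_foldr Y Z (eY : Y -> tree) (eZ : Z -> tree)
    (g : X -> Y -> Z -> Z) z s :
  computable eX (encode_seq eY) s -> computable eX eZ z ->
  computable (encode_pair eX (encode_pair eZ eY)) eZ
    (fun p => g p.1 p.2.2 p.2.1) ->
  computable eX eZ (fun x => foldr (g x) (z x) (s x)).
Proof.
move=> cs cz cg.
have [F cF FP] := computable_foldl (g := fun x a y => g x y a)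
  (computable_rev cs) cz cg.
by exists F => // x; rewrite FP foldl_rev.
Qed.

Lemma computable_all Y (eY : Y -> tree) (b : X -> Y -> bool) s :
  computable eX (encode_seq eY) s ->
  computable (encode_pair eX eY) encode_bool (fun p => b p.1 p.2) ->
  computable eX encode_bool (fun x => all (b x) (s x)).
Proof.
move=> cs cb.
have [F cF FP] : computable eX encode_bool
    (fun x => foldr (fun y c => b x y && c) true (s x)).
  apply: (@computable_foldr _ _ eY _ (fun x y c => b x y && c)) => //.
    exact: computable_const.
  have ci := @computable_id _ (encode_pair eX (encode_pair encode_bool eY)).
  have cp := computable_snd ci.
  apply: computable_and (computable_fst cp).
  exact: (computable_comp (f := fun p => (p.1, p.2.2)) cb
    (computable_pair (computable_fst ci) (computable_snd cp))).
by exists F => // x; rewrite FP; elim: (s x).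
Qed.

Lemma computable_map Y Z (eY : Y -> tree) (eZ : Z -> tree) (f : X -> Y -> Z) s :
  computable eX (encode_seq eY) s ->
  computable (encode_pair eX eY) eZ (fun p => f p.1 p.2) ->
  computable eX (encode_seq eZ) (fun x => map (f x) (s x)).
Proof.
move=> cs cf.
have [F cF FP] : computable eX (encode_seq eZ)
    (fun x => foldr (fun y l => f x y :: l) [::] (s x)).
  apply: (@computable_foldr _ _ eY _ (fun x y l => f x y :: l)) => //.
    exact: computable_const.
  have ci := @computable_id _ (encode_pair eX (encode_pair (encode_seq eZ) eY)).
  have cp := computable_snd ci.
  apply: computable_cons (computable_fst cp).
  exact: (computable_comp (f := fun p => (p.1, p.2.2)) cf
    (computable_pair (computable_fst ci) (computable_snd cp))).
by exists F => // x; rewrite FP; elim: (s x).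
Qed.

Lemma computable_filter Y (eY : Y -> tree) (b : X -> Y -> bool) s :
  computable eX (encode_seq eY) s ->
  computable (encode_pair eX eY) encode_bool (fun p => b p.1 p.2) ->
  computable eX (encode_seq eY) (fun x => filter (b x) (s x)).
Proof.
move=> cs cb.
have [F cF FP] : computable eX (encode_seq eY)
    (fun x => foldr (fun y l => if b x y then y :: l else l) [::] (s x)).
  apply: (@computable_foldr _ _ eY _ (fun x y l => if b x y then y :: l else l)) => //.
    exact: computable_const.
  have ci := @computable_id _ (encode_pair eX (encode_pair (encode_seq eY) eY)).
  have cp := computable_snd ci; have cl := computable_fst cp.
  apply: computable_if (computable_cons (computable_snd cp) cl) cl.
  exact: (computable_comp (f := fun p => (p.1, p.2.2)) cb
    (computable_pair (computable_fst ci) (computable_snd cp))).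
by exists F => // x; rewrite FP; elim: (s x).
Qed.

Lemma computable_cat Y (eY : Y -> tree) s t :
  computable eX (encode_seq eY) s -> computable eX (encode_seq eY) t ->
  computable eX (encode_seq eY) (fun x => s x ++ t x).
Proof.
move=> cs ct.
have [F cF FP] : computable eX (encode_seq eY)
    (fun x => foldr cons (t x) (s x)).
  apply: (@computable_foldr _ _ eY _ (fun _ => cons)) => //.
  have cp := computable_snd
    (@computable_id _ (encode_pair eX (encode_pair (encode_seq eY) eY))).
  exact: computable_cons (computable_snd cp) (computable_fst cp).
exists F => // x; rewrite FP; congr encode_seq.
by elim: (s x) => //= y l ->.
Qed.

End Sequences.

Section Sequences2.
Variables (X : Type) (eX : X -> tree).

Lemma computable_flatten Y (eY : Y -> tree) s :
  computable eX (encode_seq (encode_seq eY)) s ->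
  computable eX (encode_seq eY) (fun x => flatten (s x)).
Proof.
move=> cs; apply: (@computable_foldr _ _ _ _ _ _ (fun _ => cat)) cs _ _.
  exact: computable_const.
have cp := computable_snd (@computable_id _
  (encode_pair eX (encode_pair (encode_seq eY) (encode_seq eY)))).
exact: computable_cat (computable_snd cp) (computable_fst cp).
Qed.

Lemma computable_size Y (eY : Y -> tree) s :
  computable eX (encode_seq eY) s -> computable eX encode_nat (fun x => size (s x)).
Proof.
move=> cs.
have [F cF FP] : computable eX encode_nat (fun x => foldr (fun=> succn) 0 (s x)).
  apply: (@computable_foldr _ _ _ _ _ _ (fun _ _ => succn)) cs _ _.
    exact: computable_const.
  apply: computable_succ.
  exact: computable_fst (computable_snd (@computable_id _
    (encode_pair eX (encode_pair encode_nat eY)))).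
by exists F => // x; rewrite FP; elim: (s x).
Qed.

Lemma computable_nth Y (eY : Y -> tree) (s : X -> seq (seq Y)) n :
  computable eX (encode_seq (encode_seq eY)) s -> computable eX encode_nat n ->
  computable eX (encode_seq eY) (fun x => nth [::] (s x) (n x)).
Proof.
move=> cs cn.
have [F cF FP] : computable eX (encode_seq (encode_seq eY))
    (fun x => iter (n x) behead (s x)).
  apply: (@computable_iter _ _ _ _ (fun _ => behead)) cn cs _.
  exact: computable_behead (computable_snd (@computable_id _ _)).
exists (fun t => hd_tree (F t)).
  exact: tree_computable_comp tree_computable_hd cF.
move=> x; rewrite FP; elim: (n x) (s x) => [|m IHm] l; first by case: l.
by rewrite iterSr IHm nth_behead.
Qed.

End Sequences2.

Lemma encode_nat_inj : injective encode_nat.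
Proof. by elim=> [|m IHm] [|n] //= [/IHm->]. Qed.

Lemma encode_seq_inj (Y : Type) (eY : Y -> tree) :
  injective eY -> injective (encode_seq eY).
Proof. by move=> eYI; elim=> [|y s IHs] [|z t] //= [/eYI-> /IHs->]. Qed.

Lemma encode_letter_inj (A : finType) : injective (@encode_letter A).
Proof. by move=> a b /encode_nat_inj /ord_inj /enum_rank_inj. Qed.

Lemma computable_computes X Y (eX : X -> tree) (eY : Y -> tree) f :
  computable eX eY f -> exists c, forall x, computes c (eX x) (eY (f x)).
Proof.
move=> [F [c cP] FP]; exists (c 0) => x; rewrite -FP.
by have [s' [e v _]] := cP 0 [:: eX x]; exists s'.
Qed.

Local Open Scope classical_set_scope.

(** * Morphisms given by the images of the letters *)

Section Extension.
Variables (A : finType) (B : Type).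
Implicit Types (D : {set A}) (f : A -> seq B) (u v : seq A).

Definition ext f u : seq B := flatten (map f u).

Lemma ext_cat f u v : ext f (u ++ v) = ext f u ++ ext f v.
Proof. by rewrite /ext map_cat flatten_cat. Qed.

Definition word_on D u := all (fun a => a \in D) u.

(** Markedness relative to a set of letters: the successors of a pair of morphisms
are defined only on some of the letters, and keeping the ambient alphabet fixed
makes the pairs that occur in the descent comparable. *)
Definition marked_on D f : Prop :=
  (forall a, a \in D -> f a <> [::]) /\
  (forall a b, a \in D -> b \in D -> ohead (f a) = ohead (f b) -> a = b).

Lemma word_on_cat D u v : word_on D (u ++ v) = word_on D u && word_on D v.
Proof. exact: all_cat. Qed.

Lemma ohead_ext D f a u : marked_on D f -> a \in D ->
  ohead (ext f (a :: u)) = ohead (f a).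
Proof. by move=> [f0 _] /f0; rewrite /ext /=; case: (f a). Qed.

Lemma ext_eq_nil D f u : marked_on D f -> word_on D u -> ext f u = [::] -> u = [::].
Proof. by case: u => //= a u [f0 _] /andP[/f0]; rewrite /ext /=; case: (f a). Qed.

Lemma ohead_ext_inj D f u v : marked_on D f -> word_on D u -> word_on D v ->
  ohead (ext f u) = ohead (ext f v) -> ohead u = ohead v.
Proof.
move=> fM; case: u v => [|a u] [|b v] //=.
- move=> _ /andP[bD _]; rewrite (ohead_ext _ fM bD).
  by case: (fM) => /(_ _ bD); case: (f b).
- move=> /andP[aD _] _; rewrite (ohead_ext _ fM aD).
  by case: (fM) => /(_ _ aD); case: (f a).
- move=> /andP[aD _] /andP[bD _]; rewrite !(@ohead_ext D) //.
  by case: fM => _ fI /fI ->.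
Qed.

Lemma size_ext_ge D f u : marked_on D f -> word_on D u -> size u <= size (ext f u).
Proof.
move=> [f0 _]; elim: u => //= a u IHu /andP[/f0 fa /IHu{}IHu].
rewrite /ext /= size_cat -add1n leq_add //; by case: (f a) fa.
Qed.

Lemma size_ext_le D f u m : (forall a, a \in D -> size (f a) <= m) ->
  word_on D u -> size (ext f u) <= m * size u.
Proof.
move=> fm; elim: u => //= a u IHu /andP[/fm fa /IHu{}IHu].
by rewrite /ext /= size_cat mulnS leq_add.
Qed.

End Extension.

Lemma ext_ext (A B : finType) C (f : B -> seq C) (g : A -> seq B) u :
  ext (fun a => ext f (g a)) u = ext f (ext g u).
Proof. by elim: u => // a u IHu; rewrite [RHS]ext_cat -IHu. Qed.

Lemma word_on_ext (A B : finType) (D : {set A}) (E : {set B}) f u :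
  (forall a, a \in D -> word_on E (f a)) -> word_on D u -> word_on E (ext f u).
Proof.
move=> fE; elim: u => //= a u IHu /andP[/fE fa /IHu{}IHu].
by rewrite word_on_cat fa.
Qed.

Lemma marked_on_ext (A B : finType) C (D : {set A}) (E : {set B})
    (f : B -> seq C) (g : A -> seq B) :
  (forall a, a \in D -> word_on E (g a)) -> marked_on E f -> marked_on D g ->
  marked_on D (fun a => ext f (g a)).
Proof.
move=> gE fM [g0 gI]; split=> [a aD /(ext_eq_nil fM (gE _ aD)) | a b aD bD].
  exact: g0.
by move=> /(ohead_ext_inj fM (gE _ aD) (gE _ bD)); apply: gI.
Qed.

(** * Synchronisation of marked morphisms *)

Lemma cat_eq_cat (B : Type) (a b c d : seq B) : a ++ b = c ++ d ->
  exists r, (c = a ++ r /\ b = r ++ d) \/ (a = c ++ r /\ d = r ++ b).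
Proof.
elim: a c => [|x a IHa] [|y c] /=.
- by move=> ->; exists [::]; left.
- by move=> ->; exists (y :: c); left.
- by move=> <-; exists (x :: a); right.
- by move=> [-> /IHa[r [[-> ->]|[-> ->]]]]; exists r; [left | right].
Qed.

Lemma cat_injl (B : Type) (a b c : seq B) : a ++ b = a ++ c -> b = c.
Proof. by elim: a => //= x a IHa [/IHa]. Qed.

(** The remainders of two words after their longest common prefix. *)
Definition fork (A : Type) (s t : seq A) : Prop :=
  ohead s = ohead t -> s = [::] /\ t = [::].

Lemma fork_exists (A : Type) (u v : seq A) :
  exists p s t, [/\ u = p ++ s, v = p ++ t & fork s t].
Proof.
elim: u v => [|a u IHu] [|b v]; do ?by exists [::]; do 2!eexists; split.
have [<-|ab] := pselect (a = b).
  by have [p [s [t [-> -> st]]]] := IHu v; exists (a :: p), s, t.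
by exists [::]; do 2!eexists; split; first [reflexivity | by case].
Qed.

Section Synchronisation.
Variables (A : finType) (B : Type) (D : {set A}) (f g : A -> seq B).
Hypotheses (fM : marked_on D f) (gM : marked_on D g).

(** A non-empty common prefix of h s and h s' determines the first letters of s
and s', as h is marked. *)
Lemma fork_ext (h : A -> seq B) s s' r w w' : marked_on D h ->
  word_on D s -> word_on D s' -> fork s s' ->
  ext h s = r ++ w -> ext h s' = r ++ w' -> r = [::].
Proof.
case: r => // x r hM sD s'D ss' e e'.
have /ss'[s0 _] : ohead s = ohead s' by apply: (ohead_ext_inj hM); rewrite ?e ?e'.
by move: e; rewrite s0.
Qed.

(** Whichever side is ahead of the other forces the next letter of the side that
lags behind, so that the branches s, s' (or t, t') cannot differ at this point:
two derivations that fork do so when both sides are level. *)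
Lemma synchronised a c s s' t t' :
  word_on D s -> word_on D s' -> word_on D t -> word_on D t' -> fork s s' -> fork t t' ->
  a ++ ext f s = c ++ ext g t -> a ++ ext f s' = c ++ ext g t' -> a = c.
Proof.
move=> sD s'D tD t'D ss' tt' e e'.
have [r [[ca fs]|[ac gt]]] := cat_eq_cat e; subst.
- have fs' : ext f s' = r ++ ext g t' by apply: (@cat_injl _ a); rewrite e' catA.
  by rewrite (fork_ext fM sD s'D ss' fs fs') cats0.
- have gt' : ext g t' = r ++ ext f s' by apply: (@cat_injl _ c); rewrite -e' catA.
  by rewrite (fork_ext gM tD t'D tt' gt gt') cats0.
Qed.

End Synchronisation.

(** * Atoms and bases of equalisers *)

Section Atoms.
Variable A : finType.
Implicit Types (P : seq A -> Prop) (x : seq A).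

Definition atom P x : Prop :=
  [/\ P x, x <> [::] & forall u v, x = u ++ v -> P u -> P v -> u = [::] \/ v = [::]].

Lemma factor P x : P x -> exists2 ys, {in ys, forall y, atom P y} & x = flatten ys.
Proof.
have [n] := ubnP (size x); elim: n x => // n IHn x xn Px.
have [->|x0] := pselect (x = [::]); first by exists [::].
have [xA|xA] := pselect (atom P x).
  by exists [:: x]; rewrite /= ?cats0 // => y; rewrite inE => /eqP->.
have [u [v [xuv Pu Pv u0 v0]]] : exists u v,
    [/\ x = u ++ v, P u, P v, u <> [::] & v <> [::]].
  apply: contrapT => no; apply: xA; split => // u v xuv Pu Pv.
  have [?|u0] := pselect (u = [::]); first by left.
  have [?|v0] := pselect (v = [::]); first by right.
  by case: no; exists u, v.
have [un vn] : size u < n /\ size v < n.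
  move: xn; rewrite xuv size_cat.
  by case: u v {xuv Pu Pv} u0 v0 => [//|a u] [//|b v] /=; lia.
rewrite xuv; have [us usA ->] := IHn u un Pu; have [vs vsA ->] := IHn v vn Pv.
exists (us ++ vs); rewrite ?flatten_cat // => y.
by rewrite mem_cat => /orP[/usA|/vsA].
Qed.

Lemma factor_ext (T : finType) (E : {set T}) (psi : T -> seq A) P x :
  (forall y, atom P y -> exists2 a, a \in E & y = psi a) -> P x ->
  exists2 y, word_on E y & x = ext psi y.
Proof.
move=> psiP /factor[ys ysA ->]; elim: ys ysA => [|y ys IHys] ysA.
  by exists [::].
have [z zE e] := IHys (fun w ws => ysA w (mem_behead (s := y :: ys) ws)).
have [a aE ->] := psiP y (ysA y (mem_head _ _)).
by exists (a :: z); rewrite /= ?aE // e.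
Qed.

End Atoms.

Section Equalised.
Variables (A : finType) (B : Type).
Implicit Types (D : {set A}) (F : set (A -> seq B)) (u v x : seq A).

Definition equalised D F x : Prop :=
  word_on D x /\ forall f g, F f -> F g -> ext f x = ext g x.

Lemma equalised_cat D F u v :
  equalised D F u -> equalised D F v -> equalised D F (u ++ v).
Proof.
move=> [uD uF] [vD vF]; split; first by rewrite word_on_cat uD.
by move=> f g Ff Fg; rewrite !ext_cat (uF f g) // (vF f g).
Qed.

Lemma equalised_drop D F u v :
  equalised D F (u ++ v) -> equalised D F u -> equalised D F v.
Proof.
rewrite /equalised word_on_cat => -[/andP[_ vD] uvF] [_ uF]; split=> // f g Ff Fg.
by have := uvF f g Ff Fg; rewrite !ext_cat (uF f g Ff Fg) => /cat_injl.
Qed.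

(** The longest common prefix p of x and y is itself in the equaliser, because
solutions fork only where all the morphisms agree; x and y being irreducible,
both are equal to p. *)
Lemma atom_head_inj D F x y : (forall f, F f -> marked_on D f) ->
  atom (equalised D F) x -> atom (equalised D F) y -> ohead x = ohead y -> x = y.
Proof.
move=> FM [[xD xF] x0 xA] [[yD yF] y0 yA] xy.
have [p [s [t [xps ypt st]]]] := fork_exists x y; subst.
move: (xD) (yD); rewrite !word_on_cat => /andP[pD sD] /andP[_ tD].
have p0 : p <> [::].
  by move=> p0; move: xy x0; rewrite p0 /= => /st[-> _].
have pF : equalised D F p.
  split => // f g Ff Fg.
  apply: (synchronised (FM f Ff) (FM g Fg) sD tD sD tD st st).
    by rewrite -!ext_cat; apply: xF.
  by rewrite -!ext_cat; apply: yF.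
have [//|->] := xA p s erefl pF (equalised_drop (conj xD xF) pF).
by have [//|->] := yA p t erefl pF (equalised_drop (conj yD yF) pF).
Qed.

(** The alphabet of the basis can be taken inside A: name an atom by its first
letter. *)
Lemma equalised_basis D F : (forall f, F f -> marked_on D f) ->
  exists (E : {set A}) (psi : A -> seq A),
    [/\ marked_on E psi, forall a, a \in E -> atom (equalised D F) (psi a)
      & forall x, atom (equalised D F) x -> exists2 a, a \in E & x = psi a].
Proof.
move=> FM; pose Q a := [set x | atom (equalised D F) x /\ ohead x = Some a].
pose E := finset (fun a => `[< exists x, Q a x >]).
pose psi a := xget [::] (Q a).
have psiP a : a \in E -> Q a (psi a) by rewrite inE => /asboolP; apply: xgetPex.
exists E, psi; split.
- split=> [a /psiP[[] //]|a b /psiP[_ ->] /psiP[_ ->] [] //].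
- by move=> a /psiP[].
- case=> [[]//|a x] xA.
  have aE : a \in E by rewrite inE; apply/asboolP; exists (a :: x).
  have [pA pa] := psiP a aE; exists a => //.
  by apply: atom_head_inj xA pA _; rewrite // pa.
Qed.

End Equalised.

(** * Blocks of a pair of marked morphisms *)

Section Closing.
Variables (A : finType) (B : Type) (D : {set A}).
Implicit Types (g h : A -> seq B) (u v : seq A) (z : seq B).

(** The pair (u, v) is a shortest way to make both sides level again when h is
ahead of g by the overhang z. For an empty overhang these are the blocks of
(g, h); the condition on p excludes the trivial start. *)
Definition closing g h z u v : Prop :=
  [/\ word_on D u, word_on D v, u <> [::], ext g u = z ++ ext h v
    & forall p s q t, u = p ++ s -> v = q ++ t -> ext g p = z ++ ext h q ->
        p <> [::] -> s = [::] /\ t = [::]].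

(** A block is determined by its overhang or, when this is empty, by the first
letter of u: two completions fork at a level point, and being minimal both end
there. *)
Lemma closing_inj g h z u v u' v' : marked_on D g -> marked_on D h ->
  closing g h z u v -> closing g h z u' v' ->
  z <> [::] \/ ohead u = ohead u' -> u = u' /\ v = v'.
Proof.
move=> gM hM [uD vD u0 uv uvC] [u'D v'D u'0 uv' uvC'] zu.
have [p [s [s' [eu eu' ss']]]] := fork_exists u u'.
have [q [t [t' [ev ev' tt']]]] := fork_exists v v'.
subst; move: uD vD u'D v'D; rewrite !word_on_cat.
move=> /andP[pD sD] /andP[qD tD] /andP[_ s'D] /andP[_ t'D].
have pq : ext g p = z ++ ext h q.
  apply: (synchronised gM hM sD s'D tD t'D ss' tt').
    by rewrite -catA -!ext_cat.
  by rewrite -catA -!ext_cat.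
have p0 : p <> [::].
  move=> p0; move: pq zu u0; rewrite p0 /=; case: z {uv uvC uv' uvC'} => //= _ [] //.
  by move=> /ss'[->].
have [-> ->] := uvC p s q t erefl erefl pq p0.
by have [-> ->] := uvC' p s' q t' erefl erefl pq p0.
Qed.

Lemma closing_sym g h u v : marked_on D g -> marked_on D h ->
  closing g h [::] u v -> closing h g [::] v u.
Proof.
move=> gM hM [uD vD u0 uv uvC]; split=> //.
- by move=> v0; apply: u0; apply: (ext_eq_nil gM uD); rewrite uv v0.
- move=> q t p s ev eu qp q0.
  suff p0 : p <> [::] by have [-> ->] := uvC p s q t eu ev (esym qp) p0.
  move=> p0; apply: q0; apply: (ext_eq_nil hM); last by rewrite qp p0.
  by move: vD; rewrite ev word_on_cat => /andP[].
Qed.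

Lemma closing_exists g h u v : marked_on D g -> marked_on D h ->
  word_on D u -> word_on D v -> u <> [::] -> ext g u = ext h v ->
  exists u1 u2 v1 v2, [/\ u = u1 ++ u2, v = v1 ++ v2 & closing g h [::] u1 v1].
Proof.
move=> gM hM; have [n] := ubnP (size u).
elim: n u v => // n IHn u v un uD vD u0 uv.
have [uvC|uvC] := pselect (closing g h [::] u v).
  by exists u, [::], v, [::]; rewrite !cats0.
have [p [s [q [t [eu ev pq p0 st]]]]] : exists p s q t,
    [/\ u = p ++ s, v = q ++ t, ext g p = ext h q, p <> [::]
      & ~ (s = [::] /\ t = [::])].
  apply: contrapT => no; apply: uvC; split=> // p s q t eu ev pq p0.
  by apply: contrapT => st; apply: no; exists p, s, q, t.
subst; move: (uD) (vD); rewrite !word_on_cat => /andP[pD sD] /andP[qD tD].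
have s0 : s <> [::].
  move=> s0; apply: st; split=> //; apply: (ext_eq_nil hM tD).
  move: uv; rewrite !ext_cat s0 pq cats0 => e; symmetry; apply: (@cat_injl _ (ext h q)).
  by rewrite cats0.
have pn : size p < n.
  by move: un; rewrite size_cat; case: (s) s0 => //=; lia.
have [u1 [u2 [v1 [v2 [-> -> C]]]]] := IHn p q pn pD qD p0 pq.
by exists u1, (u2 ++ s), v1, (v2 ++ t); rewrite !catA.
Qed.

(** A cut of h v falls either between the images of two letters, or strictly
inside the image of a letter b. *)
Lemma cat_eq_ext h v w1 w2 : w1 ++ w2 = ext h v -> exists v1 v2,
  (v = v1 ++ v2 /\ w1 = ext h v1) \/
  exists b r z, [/\ v = v1 ++ b :: v2, w1 = ext h v1 ++ r, h b = r ++ z,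
    r <> [::] /\ z <> [::] & w2 = z ++ ext h v2].
Proof.
elim: v w1 => [|b v IHv] w1.
  by case: w1 => //= _; exists [::], [::]; left.
rewrite [RHS]/= /ext /= -/(ext h v) => e.
have [r [[hb w2E]|[w1E hv]]] := cat_eq_cat e; last first.
  have [v1 [v2 [[ev w1v]|[c [r' [z [ev rv hc r0 w2E]]]]]]] := IHv r (esym hv).
    by exists (b :: v1), v2; left; rewrite ev w1E w1v.
  exists (b :: v1), v2; right; exists c, r', z; split=> //; first by rewrite ev.
  by rewrite w1E rv /ext /= catA.
have [w10|w10] := pselect (w1 = [::]).
  by exists [::], (b :: v); left; rewrite w10.
have [r0|r0] := pselect (r = [::]).
  by exists [:: b], v; left; rewrite /ext /= cats0 hb r0 cats0.
by exists [::], v; right; exists b, w1, r.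
Qed.

End Closing.

(** * Suffix complexity *)

Definition covers_suffixes (A : finType) (B : eqType) (D : {set A})
    (f : A -> seq B) (Z : seq (seq B)) : Prop :=
  forall a r z, a \in D -> f a = r ++ z -> r <> [::] -> z <> [::] -> z \in Z.

(** The measure of a letter map that survives the passage to a successor is the
number of proper non-empty suffixes of letter images, not the length of these
images; it is stated through a covering list to avoid counting. *)
Definition slim (A : finType) (B : eqType) (D : {set A}) (f : A -> seq B) m :=
  exists2 Z, size Z <= m & covers_suffixes D f Z.

(** Cut the first component of a block into two non-empty parts u1 and u2. The
cut is not a level point, so g u1 ends strictly inside an image h b; the rest z
of h b is an overhang that u2 has to close, hence u2 is a function of z. The
suffixes of h thus cover those of g', in number at most equal. *)
Lemma slim_closing (A : finType) (B : eqType) (D E : {set A}) (g h : A -> seq B)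
    (g' : A -> seq A) m :
  marked_on D g -> marked_on D h -> slim D h m ->
  (forall a, a \in E -> exists v, closing D g h [::] (g' a) v) -> slim E g' m.
Proof.
move=> gM hM [Z Zm ZP] g'P.
pose phi z := xget [::] [set u | exists v, closing D g h z u v].
exists [seq phi z | z <- Z]; first by rewrite size_map.
move=> a u1 u2 /g'P[v [uD vD u0 uv uvC]] eu u10 u20.
move: uD uv; rewrite eu word_on_cat ext_cat /= => /andP[u1D u2D] uv.
have [v1 [v2 [[ev e1]|[b [r [z [ev e1 hb [r0 z0] e2]]]]]]] := cat_eq_ext uv.
  by have [] := uvC u1 u2 v1 v2 eu ev e1 u10.
move: vD; rewrite ev word_on_cat /= => /and3P[v1D bD v2D].
have C : closing D g h z u2 v2.
  split => // p s q t eu2 ev2 pq p0.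
  apply: (uvC (u1 ++ p) s (v1 ++ b :: q) t).
  - by rewrite eu eu2 catA.
  - by rewrite ev ev2 -catA.
  - by rewrite !ext_cat e1 pq /ext /= hb -!catA.
  - by case: u1 u10 {eu u1D uv e1}.
suff -> : u2 = phi z by apply: map_f; apply: ZP bD hb r0 z0.
have [v' C'] : [set u | exists v, closing D g h z u v] (phi z).
  by apply: xgetPex; exists u2, v2.
by have [] := closing_inj gM hM C C' (or_introl z0).
Qed.

(** The proper suffixes of one word have different lengths. *)
Lemma slim_size (A : finType) (B : eqType) (D : {set A}) (f : A -> seq B) m a :
  slim D f m -> a \in D -> size (f a) <= m.+1.
Proof.
move=> [Z Zm ZP] aD.
pose T := [seq drop i (f a) | i <- iota 1 (size (f a)).-1].
have : size T <= size Z.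
  apply: uniq_leq_size.
    apply: (@map_uniq _ _ size); rewrite -map_comp.
    rewrite map_inj_in_uniq ?iota_uniq // => i j; rewrite !mem_iota /= !size_drop.
    lia.
  move=> z /mapP[i]; rewrite mem_iota => /andP[i0 ia] ->.
  apply: (ZP a (take i (f a)) _ aD); rewrite ?cat_take_drop //.
    by move=> /(congr1 size); rewrite size_take /=; case: ifP; lia.
  by move=> /(congr1 size); rewrite size_drop /=; lia.
by rewrite size_map size_iota; lia.
Qed.

(** * Descent to the successor of a pair *)

Definition equal_on (A : finType) (B : Type) (D : {set A}) (g h : A -> seq B)
  (x : seq A) : Prop := word_on D x /\ ext g x = ext h x.

Lemma equal_on_drop (A : finType) (B : Type) (D : {set A}) (g h : A -> seq B) u v :
  equal_on D g h (u ++ v) -> equal_on D g h u -> equal_on D g h v.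
Proof.
rewrite /equal_on word_on_cat !ext_cat => -[/andP[_ ->] uv] [_ e].
by split=> //; move: uv; rewrite e => /cat_injl.
Qed.

Lemma equal_onE (A : finType) (B : Type) (D : {set A}) (g h : A -> seq B) :
  equal_on D g h = equalised D [set g; h].
Proof.
apply/funext => x; apply/propext; split=> [[xD e]|[xD e]].
  by split=> // f f' [->|->] [->|->].
by split=> //; apply: e; [left | right].
Qed.

Definition slim_pair (A : finType) (B : eqType) (D : {set A}) (g h : A -> seq B) m :=
  [/\ marked_on D g, marked_on D h, slim D g m & slim D h m].

(** The successor maps send the first letter of u to u and to v, for each block
(u, v); every solution x is g' y = h' y for a solution y of the successor, and y is an
atom when x is. If y is as long as x, then g' and h' send the letters of y to
single letters, so the first of these is already a solution of (g, h), and x,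
being an atom, is this letter. *)
Lemma descent (A : finType) (B : eqType) (D : {set A}) (g h : A -> seq B) m x :
  slim_pair D g h m -> atom (equal_on D g h) x ->
  exists (D' : {set A}) (g' h' : A -> seq A) y,
    [/\ slim_pair D' g' h' m, atom (equal_on D' g' h') y,
        size x <= m.+1 * size y & size y < size x \/ size x = 1].
Proof.
move=> [gM hM gS hS] [[xD xe] x0 xA].
pose Q a := [set uv : seq A * seq A |
  closing D g h [::] uv.1 uv.2 /\ ohead uv.1 = Some a].
pose D' := finset (fun a => `[< exists uv, Q a uv >]).
pose g' a := (xget ([::], [::]) (Q a)).1.
pose h' a := (xget ([::], [::]) (Q a)).2.
have D'P a : a \in D' -> closing D g h [::] (g' a) (h' a) /\ ohead (g' a) = Some a.
  by rewrite inE => /asboolP/(xgetPex ([::], [::])).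
have g'D a : a \in D' -> word_on D (g' a) by move=> /D'P[[]].
have h'D a : a \in D' -> word_on D (h' a) by move=> /D'P[[]].
have gh a : a \in D' -> ext g (g' a) = ext h (h' a) by move=> /D'P[[]].
have g'M : marked_on D' g'.
  split=> [a /D'P[[]] //|a b /D'P[_ ->] /D'P[_ ->] [] //].
have h'0 a : a \in D' -> h' a <> [::].
  move=> aD ha; have [[ga _ + e _] _] := D'P a aD.
  by apply; apply: (ext_eq_nil gM); rewrite // e ha.
have h'M : marked_on D' h'.
  split=> // a b aD bD e; apply: g'M.2 => //.
  apply: (ohead_ext_inj gM); rewrite ?g'D // !gh //.
  case: (h' a) (h' b) (h'0 a aD) (h'0 b bD) (h'D a aD) (h'D b bD) e
    => [//|c s] [//|d t] _ _ /andP[cD _] /andP[dD _] [cd].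
  by rewrite !(ohead_ext _ hM) // cd.
(* Cut off one block after the other. *)
have decomp u v : word_on D u -> word_on D v -> ext g u = ext h v ->
    exists2 y, word_on D' y & u = ext g' y /\ v = ext h' y.
  have [n] := ubnP (size u); elim: n u v => // n IHn u v un uD vD uv.
  have [u0|u0] := pselect (u = [::]).
    by exists [::]; rewrite // u0; split=> //; apply: (ext_eq_nil hM vD); rewrite -uv u0.
  have [u1 [u2 [v1 [v2 [eu ev C]]]]] := closing_exists gM hM uD vD u0 uv.
  have [_ _ u10 e1 _] := C.
  have [a ua] : exists a, ohead u1 = Some a.
    by case: u1 u10 {eu C e1} => // a w _; exists a.
  have aD : a \in D' by rewrite inE; apply/asboolP; exists (u1, v1).
  have [C' ga] := D'P a aD.
  have [e1g e1h] := closing_inj gM hM C C' (or_intror (etrans ua (esym ga))).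
  move: uD vD uv un; rewrite eu ev !word_on_cat !ext_cat e1.
  move=> /andP[_ u2D] /andP[_ v2D] /cat_injl uv2 un.
  have [|y yD [-> ->]] := IHn u2 v2 _ u2D v2D uv2.
    by move: un; rewrite size_cat; case: (u1) u10 => //=; lia.
  exists (a :: y); first by rewrite /= aD.
  by rewrite /ext /= -e1g -e1h.
have g'S : slim D' g' m.
  by apply: (slim_closing gM hM hS) => a /D'P[C _]; exists (h' a).
have h'S : slim D' h' m.
  apply: (slim_closing hM gM gS) => a /D'P[C _]; exists (g' a).
  exact: closing_sym.
have lift y : equal_on D' g' h' y -> equal_on D g h (ext g' y).
  move=> [yD e]; split; first exact: word_on_ext yD.
  rewrite [in RHS]e; elim: y yD {e} => //= a y IHy /andP[aD /IHy{}IHy].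
  by rewrite [LHS]ext_cat [RHS]ext_cat gh // IHy.
have [y yD [xg xh]] := decomp x x xD xD xe.
have yE : equal_on D' g' h' y by split=> //; rewrite -xg -xh.
exists D', g', h', y; split=> //.
- split=> //; first by move=> y0; apply: x0; rewrite xg y0.
  move=> u v yuv uE vE.
  have [] := xA (ext g' u) (ext g' v) _ (lift u uE) (lift v vE).
  + by rewrite xg yuv ext_cat.
  + by move=> /(ext_eq_nil g'M uE.1) ->; left.
  + by move=> /(ext_eq_nil g'M vE.1) ->; right.
- by rewrite {1}xg; apply: size_ext_le yD => a; apply: slim_size.
- have yx : size y <= size x by rewrite xg; apply: size_ext_ge yD.
  move: yx; rewrite leq_eqVlt => /orP[/eqP yx|]; last by left.
  right; case: y yD xg xh yE yx => [|c y]; first by move=> _ xg; case: x0.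
  move=> /= /andP[cD yD] xg xh yE yx.
  (* No letter of y has an empty image, so equal total lengths leave one letter
   for each. *)
have sz f : marked_on D' f -> x = ext f (c :: y) -> size (f c) = 1.
    move=> fM e; move: yx (size_ext_ge fM yD).
    rewrite {}e (_ : ext f (c :: y) = f c ++ ext f y) // size_cat.
    by case: (fM) => /(_ c cD); case: (f c) => //= b s _ _; lia.
  have gc := sz g' g'M xg; have hc := sz h' h'M xh.
  have e : g' c = h' c.
    move: xg xh => -> /eqP; rewrite eqseq_cat ?gc // => /andP[/eqP //].
  have cE : equal_on D g h (g' c) by split; rewrite ?g'D // gh // -e.
  have xc : x = g' c ++ ext g' y by [].
  have yE' : equal_on D g h (ext g' y).
    by apply: (@equal_on_drop _ _ _ _ _ (g' c)); rewrite -?xc.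
  have [c0|y0] := xA _ _ xc cE yE'; first by move: gc; rewrite c0.
  by rewrite xc y0 cats0.
Qed.

(** * Length bounds for atoms *)

(** Padding with None turns the words of length at most m into functions on 'I_m,
hence the letter maps with such images into elements of a finite type. *)
Definition letter_table (A B : finType) m (D : {set A}) (f : A -> seq B) :
    {ffun A -> {ffun 'I_m -> option B}} :=
  [ffun a => [ffun i : 'I_m => if a \in D then onth (f a) i else None]].

Lemma letter_table_inj (A B : finType) m (D : {set A}) (f f' : A -> seq B) :
  (forall a, a \in D -> size (f a) <= m) -> (forall a, a \in D -> size (f' a) <= m) ->
  letter_table m D f = letter_table m D f' -> forall a, a \in D -> f a = f' a.
Proof.
move=> fm f'm ff' a aD; apply: eq_from_onth => i.
have [im|mi] := ltnP i m.
  have /ffunP/(_ a) := ff'.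
  by rewrite !ffunE => /ffunP/(_ (Ordinal im)); rewrite !ffunE aD.
by rewrite !onth_default // (leq_trans _ mi) // ?fm ?f'm.
Qed.

Lemma ext_eq_in (A : finType) B (D : {set A}) (f f' : A -> seq B) u :
  (forall a, a \in D -> f a = f' a) -> word_on D u -> ext f u = ext f' u.
Proof.
move=> ff'; elim: u => // a u IHu /= /andP[aD /IHu{}IHu].
by rewrite /ext /= ff' // -!/(ext _ _) IHu.
Qed.

Section PairBound.
Variable A : finType.
Implicit Types (D : {set A}) (x : seq A).

Definition state_count s m : nat :=
  2 ^ s * ((s.+1 ^ m.+1) ^ s * ((s.+1 ^ m.+1) ^ s * s.+1)).

Definition state m D (g h : A -> seq A) x :=
  (D, (letter_table m.+1 D g, (letter_table m.+1 D h, ohead x))).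

(** An instance of the descent and an atom of it are determined by finitely many
data: the domain, the truncated letter images and the first letter of the
atom. *)
Lemma state_inj m D g h x D' g' h' x' :
  slim_pair D g h m -> slim_pair D' g' h' m ->
  atom (equal_on D g h) x -> atom (equal_on D' g' h') x' ->
  state m D g h x = state m D' g' h' x' -> x = x'.
Proof.
move=> [gM hM gS hS] [g'M h'M g'S h'S] xA x'A [] ? ; subst D'.
have sz (f : A -> seq A) : slim D f m -> forall a, a \in D -> size (f a) <= m.+1.
  by move=> fS a; apply: slim_size.
move=> /(letter_table_inj (sz _ gS) (sz _ g'S)) gg'.
move=> /(letter_table_inj (sz _ hS) (sz _ h'S)) hh' xx'.
have E : equal_on D g h = equal_on D g' h'.
  apply/funext => y; apply/propext; rewrite /equal_on.
  by split=> -[yD e]; split=> //; [rewrite -(ext_eq_in gg') // -(ext_eq_in hh')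
    | rewrite (ext_eq_in gg') // (ext_eq_in hh')].
move: xA x'A; rewrite -E equal_onE => xA x'A.
by apply: atom_head_inj xA x'A xx' => f [->|->].
Qed.

(** Along the descent lengths strictly decrease until they are 1, so no state is
repeated and there are at most as many steps as states. *)
Lemma atom_size_state m D (g h : A -> seq A) x :
  slim_pair D g h m -> atom (equal_on D g h) x ->
  size x <= m.+1 ^ state_count #|A| m.
Proof.
pose T := ({set A} * ({ffun A -> {ffun 'I_m.+1 -> option A}} *
  ({ffun A -> {ffun 'I_m.+1 -> option A}} * option A)))%type.
have cardT : #|{: T}| = state_count #|A| m.
  rewrite !card_prod !card_ffun !card_option card_ord.
  by rewrite -cardsT -powersetT card_powerset cardsT.
rewrite -cardT -[X in m.+1 ^ X]subn0 -[X in _ - X]/(size ([::] : seq T)).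
(* Induction with a list V of states already met: each of them belongs to an atom
   longer than x, and every new one reduces the exponent by 1. *)
have : uniq ([::] : seq T) by [].
have : forall D' g' h' x', slim_pair D' g' h' m -> atom (equal_on D' g' h') x' ->
    state m D' g' h' x' \in ([::] : seq T) -> size x < size x' by [].
move: [::] => V; have [n] := ubnP (size x).
elim: n D g h x V => // n IHn D g h x V xn VP Vu gh xA.
have new : state m D g h x \notin V.
  by apply/negP => /(VP _ _ _ _ gh xA); rewrite ltnn.
have V'u : uniq (state m D g h x :: V) by rewrite /= new.
have [D' [g' [h' [y [gh' yA xy yx]]]]] := descent gh xA.
case: yx => [yx|->]; last by rewrite expn_gt0.
have := IHn D' g' h' y (state m D g h x :: V) _ _ V'u gh' yA.
have -> : #|{: T}| - size V = (#|{: T}| - size (state m D g h x :: V)).+1.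
  rewrite /= subnSK //; have := max_card (mem (state m D g h x :: V)).
  by rewrite (card_uniqP V'u).
move=> IH; rewrite expnS; apply: leq_trans xy _; rewrite leq_mul2l; apply/orP; right.
apply: IH; first exact: leq_trans yx xn.
move=> D2 g2 h2 x2 gh2 x2A; rewrite inE => /orP[/eqP e|/(VP _ _ _ _ gh2 x2A)].
  by rewrite (state_inj gh2 gh x2A xA e).
exact: ltn_trans.
Qed.

(** The first descent step makes A the codomain; it accounts for the additional
factor on top of [atom_size_state]. *)
Definition pair_bound s t : nat :=
  (s * t).+1 ^ (state_count s (s * t)).+1.

(** At most t suffixes for each letter. *)
Lemma slim_of_size (B : finType) D (f : A -> seq B) t :
  (forall a, a \in D -> size (f a) <= t) -> slim D f (#|A| * t).
Proof.
move=> ft; exists [seq drop i (f a) | a <- enum A, i <- iota 0 t].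
  by rewrite size_allpairs size_iota -cardE.
move=> a r z aD fa r0 z0; apply/allpairsP; exists (a, size r); split=> /=.
- by rewrite mem_enum.
- move: (ft a aD); rewrite mem_iota fa size_cat; case: z z0 {fa} => //=; lia.
- by rewrite fa drop_size_cat.
Qed.

Lemma atom_size_pair (B : finType) D (g h : A -> seq B) t x :
  marked_on D g -> marked_on D h ->
  (forall a, a \in D -> size (g a) <= t) -> (forall a, a \in D -> size (h a) <= t) ->
  atom (equal_on D g h) x -> size x <= pair_bound #|A| t.
Proof.
move=> gM hM gt ht xA.
have gh : slim_pair D g h (#|A| * t) by split=> //; apply: slim_of_size.
have [D' [g' [h' [y [gh' yA xy _]]]]] := descent gh xA.
by apply: leq_trans xy _; rewrite /pair_bound expnS leq_mul2l (atom_size_state gh' yA).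
Qed.

Definition grow s t : nat := t * pair_bound s t.

Lemma atom_size_free (B : Type) D (F : set (A -> seq B)) g x :
  (forall f, F f -> f = g) -> atom (equalised D F) x -> size x = 1.
Proof.
move=> Fg [[xD _] x0 xA]; case: x x0 xD xA => // a w _ xD xA.
have wE u : word_on D u -> equalised D F u by move=> uD; split=> // f h /Fg-> /Fg->.
move: xD => /= /andP[aD wD].
have [||//|->] // := xA [:: a] w erefl; apply: wE => //=; by rewrite aD.
Qed.

(** Replace g, f by the basis psi of their equaliser: the other morphisms, composed
with psi, have letter images longer by a factor of at most [pair_bound], and so
has x compared to its preimage y. Including the factor t on the left lets the
same function [grow] account for both. *)
Lemma atom_size_seq (B : finType) D (g : A -> seq B) fs t x :
  (forall f, f \in g :: fs -> marked_on D f /\ forall a, a \in D -> size (f a) <= t) ->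
  atom (equalised D [set f | f \in g :: fs]) x ->
  size x * t <= iter (size fs) (grow #|A|) t.
Proof.
have [n] : exists n, n = size fs by exists (size fs).
move=> nfs; rewrite -nfs.
elim: n fs nfs D g t x => [|n IHn] [|f fs] // nfs D g t x gfs xA.
  rewrite (atom_size_free (g := g) _ xA) ?mul1n // => f /=.
  by rewrite inE => /eqP.
have [gM gt] := gfs g (mem_head _ _).
have [fM ft] : marked_on D f /\ forall a, a \in D -> size (f a) <= t.
  by apply: gfs; rewrite !inE eqxx orbT.
have [E [psi [psiM psiA psiP]]] : exists (E : {set A}) psi,
    [/\ marked_on E psi, forall a, a \in E -> atom (equal_on D g f) (psi a)
      & forall x, atom (equal_on D g f) x -> exists2 a, a \in E & x = psi a].
  by rewrite equal_onE; apply: equalised_basis => h [->|->].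
have psiD a : a \in E -> word_on D (psi a) by move=> /psiA[[]].
have psit a : a \in E -> size (psi a) <= pair_bound #|A| t.
  by move=> /psiA; apply: atom_size_pair.
have [[xD xE] x0 xI] := xA.
have [|y yE xy] := factor_ext (x := x) psiP.
  by split=> //; apply: xE; rewrite /= !inE eqxx ?orbT.
pose comp (h : A -> seq B) a := ext h (psi a).
have gf_eq u : word_on E u -> ext g (ext psi u) = ext f (ext psi u).
  elim: u => //= a u IHu /andP[aE /IHu{}IHu].
  by rewrite [ext g _]ext_cat [ext f _]ext_cat IHu; have [[_ ->] _ _] := psiA a aE.
have lift u : equalised E [set h | h \in comp g :: map comp fs] u ->
    equalised D [set h | h \in g :: f :: fs] (ext psi u).
  move=> [uE uF]; split; first exact: word_on_ext uE.
  have key h : h \in g :: f :: fs -> ext h (ext psi u) = ext g (ext psi u).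
    rewrite !inE => /or3P[/eqP->|/eqP->|hfs] //; first by rewrite gf_eq.
    rewrite -!ext_ext; apply: uF; rewrite /= !inE ?eqxx //.
    by rewrite (map_f comp hfs) orbT.
  by move=> h h' /= /key-> /key->.
have yA : atom (equalised E [set h | h \in comp g :: map comp fs]) y.
  split.
  - split=> // h h' /=; rewrite -!map_cons => /mapP[k kfs ->] /mapP[k' k'fs ->].
    rewrite !ext_ext -xy; apply: xE => /=.
      by move: kfs; rewrite !inE => /orP[->|->]; rewrite ?orbT.
    by move: k'fs; rewrite !inE => /orP[->|->]; rewrite ?orbT.
  - by move=> y0; apply: x0; rewrite xy y0.
  move=> u v yuv uE vE.
  have [||] := xI (ext psi u) (ext psi v) _ (lift u uE) (lift v vE).
  + by rewrite xy yuv ext_cat.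
  + by move=> /(ext_eq_nil psiM uE.1) ->; left.
  + by move=> /(ext_eq_nil psiM vE.1) ->; right.
have step : size x * t <= size y * grow #|A| t.
  rewrite /grow (mulnC t) mulnA leq_mul2r mulnC xy.
  by rewrite (size_ext_le psit yE) orbT.
apply: leq_trans step _; rewrite iterSr.
apply: (IHn (map comp fs)) yA; first by rewrite size_map; case: nfs.
move=> h; rewrite -map_cons => /mapP[k kfs ->].
have [kM kt] : marked_on D k /\ forall a, a \in D -> size (k a) <= t.
  by apply: gfs; move: kfs; rewrite !inE => /orP[->|->]; rewrite ?orbT.
split; first exact: marked_on_ext psiD kM psiM.
move=> a aE; apply: leq_trans (size_ext_le kt (psiD a aE)) _.
by rewrite leq_mul2l psit ?orbT.
Qed.

End PairBound.

(** * Enumeration of the atoms *)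

Section Words.
Variable A : finType.

Definition words_below n : seq (seq A) :=
  iter n (fun ws => [::] :: flatten [seq [seq a :: w | w <- ws] | a <- enum A]) [::].

Lemma mem_words_below n w : (w \in words_below n) = (size w < n).
Proof.
elim: n w => // n IHn [|a w]; rewrite [words_below _]/= inE //=.
rewrite ltnS -IHn; apply/allpairsPdep/idP => [[b [v [_ vn [_ ->]]]]//|wn].
by exists a, w; rewrite mem_enum.
Qed.

Lemma words_below_uniq n : uniq (words_below n).
Proof.
elim: n => //= n IHn; apply/andP; split.
  by apply/allpairsPdep => -[a [w []]].
apply: allpairs_uniq_dep => //; first exact: enum_uniq.
by move=> [a v] [b w] _ _ /= [-> ->].
Qed.

End Words.

(** In a list that holds all the non-empty solutions up to some length, a word is
an atom exactly when it is not the product of two words of the list. *)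
Definition irreducibles (A : eqType) (s : seq (seq A)) : seq (seq A) :=
  [seq w <- s | all (fun u => all (fun v => w != u ++ v) s) s].

Section Algorithm.
Variables Sigma Delta : finType.
Implicit Types (m : seq (seq Delta)) (ms : seq (seq (seq Delta))).

Definition apply_table m (w : seq Sigma) : seq Delta :=
  flatten [seq nth [::] m (enum_rank a) | a <- w].

Definition solutions ms n : seq (seq Sigma) :=
  [seq w <- words_below Sigma n | (w != [::]) &&
    all (fun m => all (fun m' => apply_table m w == apply_table m' w) ms) ms].

(** The starting value is the total length of all letter images, a bound for each
of them; the successor keeps it positive when there are no letters or
morphisms. *)
Definition length_bound ms : nat :=
  iter (size ms) (grow #|Sigma|) (size (flatten (flatten ms))).+1.

Definition equaliser_basis ms : seq (seq Sigma) :=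
  irreducibles (solutions ms (length_bound ms).+1).

Definition letter_images (f : seq Sigma -> seq Delta) (a : Sigma) : seq Delta :=
  f [:: a].

Definition table (f : Sigma -> seq Delta) : seq (seq Delta) :=
  [seq f a | a <- enum Sigma].

Lemma apply_table_ext f w : apply_table (table f) w = ext f w.
Proof.
rewrite /apply_table /ext; congr flatten; apply: eq_map => a.
by rewrite /table (nth_map a) ?nth_enum_rank // -cardE.
Qed.

Lemma mem_solutions (gs : seq (Sigma -> seq Delta)) n w :
  (w \in solutions (map table gs) n) =
  [&& size w < n, w != [::] & `[< equalised [set: Sigma]%SET [set g | g \in gs] w >]].
Proof.
rewrite mem_filter mem_words_below andbC; congr (_ && (_ && _)).
apply/allP/asboolP => [eqw|[_ eqw] _ /mapP[f ffs ->]].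
  split; first by apply/allP => a; rewrite inE.
  move=> f g /= ffs gfs; have /allP/(_ _ (map_f table gfs)) := eqw _ (map_f table ffs).
  by rewrite !apply_table_ext => /eqP.
by apply/allP => _ /mapP[g gfs ->]; rewrite !apply_table_ext; apply/eqP/eqw.
Qed.

(** The head g of the list serves as reference and also stays in the list; the
number of iterations in [atom_size_seq] is then the number of all morphisms. *)
Lemma atom_length_bound (gs : seq (Sigma -> seq Delta)) x :
  (forall g, g \in gs -> marked_on [set: Sigma]%SET g) ->
  atom (equalised [set: Sigma]%SET [set g | g \in gs]) x ->
  size x <= length_bound (map table gs).
Proof.
move=> gsM xA; rewrite /length_bound; set t := (size _).+1.
have gst g : g \in gs -> forall a, size (g a) <= t.
  move=> ggs a; rewrite /t ltnW // ltnS; elim: gs ggs {gsM xA t} => //= h gs IHgs.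
  rewrite flatten_cat size_cat inE => /orP[/eqP<-|/IHgs]; last lia.
  apply: leq_trans (leq_addr _ _); rewrite /table.
  have : a \in enum Sigma by rewrite mem_enum.
  elim: (enum Sigma) => //= b s IHs; rewrite size_cat inE => /orP[/eqP<-|/IHs]; lia.
apply: (@leq_trans (size x * t)); first by rewrite leq_pmulr.
case: gs gsM xA @t gst => [|g gs] gsM xA t gst.
  have [a sa|none] := pickP (pred_of_simpl (@predT Sigma)).
    by rewrite (atom_size_free (g := fun=> [::]) _ xA).
  by case: x xA => [[] //|a]; have := none a.
rewrite size_map; apply: (@atom_size_seq _ _ [set: Sigma]%SET g (g :: gs)).
  move=> f; rewrite inE => /orP[/eqP->|fgs].
    by split=> [|a _]; [apply: gsM | apply: gst]; rewrite mem_head.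
  by split=> [|a _]; [apply: gsM | apply: gst].
have -> // : [set f | f \in g :: g :: gs] = [set f | f \in g :: gs].
by apply/funext => f; rewrite /= !inE orbA orbb.
Qed.

Lemma mem_equaliser_basis (gs : seq (Sigma -> seq Delta)) x :
  (forall g, g \in gs -> marked_on [set: Sigma]%SET g) ->
  x \in equaliser_basis (map table gs) <->
  atom (equalised [set: Sigma]%SET [set g | g \in gs]) x.
Proof.
move=> gsM; rewrite mem_filter mem_solutions; split.
  move=> /andP[/allP xA /and3P[xn /eqP x0 /asboolP xE]]; split=> // u v xuv uE vE.
  apply: contrapT => /not_orP[/eqP u0 /eqP v0].
  have uS : u \in solutions (map table gs) (length_bound (map table gs)).+1.
    rewrite mem_solutions u0; apply/andP; split; last exact/asboolP.
    by apply: leq_ltn_trans xn; rewrite xuv size_cat leq_addr.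
  have vS : v \in solutions (map table gs) (length_bound (map table gs)).+1.
    rewrite mem_solutions v0; apply/andP; split; last exact/asboolP.
    by apply: leq_ltn_trans xn; rewrite xuv size_cat leq_addl.
  by have /allP/(_ v vS) := xA u uS; rewrite xuv eqxx.
move=> xA; have [xE /eqP x0 xI] := xA.
rewrite ltnS (atom_length_bound gsM xA) x0 andTb; apply/andP; split; last exact/asboolP.
apply/allP => u; rewrite mem_solutions => /and3P[_ /eqP u0 /asboolP uE].
apply/allP => v; rewrite mem_solutions => /and3P[_ /eqP v0 /asboolP vE].
by apply/eqP => xuv; case: (xI u v xuv uE vE).
Qed.

Lemma equaliser_basis_uniq ms : uniq (equaliser_basis ms).
Proof. by do 2!apply: filter_uniq; apply: words_below_uniq. Qed.

End Algorithm.

(** * Computability of the enumeration *)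

Section Computability.

Lemma computable_grow X (eX : X -> tree) s n :
  computable eX encode_nat n -> computable eX encode_nat (fun x => grow s (n x)).
Proof.
move=> cn; have cst k : computable eX encode_nat (fun=> k) by exact: computable_const.
have cm := computable_mul (cst s) cn; have cm1 := computable_succ cm.
have ce := computable_exp (computable_exp (cst s.+1) cm1) (cst s).
apply: computable_mul cn _; apply: computable_exp cm1 (computable_succ _).
apply: computable_mul; first exact: cst.
apply: computable_mul; first exact: ce.
by apply: computable_mul; [exact: ce | exact: cst].
Qed.

Variables Sigma Delta : finType.
Let eword := @encode_word Sigma.
Let eimage := @encode_word Delta.

Lemma computable_apply_table X (eX : X -> tree) m (w : X -> seq Sigma) :
  computable eX (encode_seq eimage) m -> computable eX eword w ->
  computable eX eimage (fun x => apply_table (m x) (w x)).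
Proof.
move=> cm cw; apply: computable_flatten.
apply: (@computable_map _ _ _ _ _ _ (fun x a => nth [::] (m x) (enum_rank a))) cw _.
apply: computable_nth; first exact: computable_weaken.
(* A letter and its rank have the same encoding. *)
have [F cF FP] := computable_snd
  (@computable_id _ (encode_pair eX (@encode_letter Sigma))).
by exists F.
Qed.

Lemma computable_words_below X (eX : X -> tree) n :
  computable eX encode_nat n ->
  computable eX (encode_seq eword) (fun x => words_below Sigma (n x)).
Proof.
move=> cn; apply: (@computable_iter _ _ _ _ (fun _ ws =>
   [::] :: flatten [seq [seq a :: w | w <- ws] | a <- enum Sigma])) cn _ _.
  exact: computable_const.
apply: computable_cons; first exact: computable_const.
apply: computable_flatten.
apply: (@computable_map _ _ _ _ (@encode_letter Sigma) (encode_seq eword)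
   (fun x a => [seq a :: w | w <- x.2]) (fun=> enum Sigma)).
  exact: computable_const.
have ci := @computable_id _
  (encode_pair (encode_pair eX (encode_seq eword)) (@encode_letter Sigma)).
apply: (@computable_map _ _ _ _ eword eword (fun x w => x.2 :: w)).
  exact: computable_snd (computable_fst ci).
set e := encode_pair _ _ in ci.
have cj := @computable_id _ (encode_pair e eword).
exact: computable_cons (computable_snd (computable_fst cj)) (computable_snd cj).
Qed.

Lemma computable_irreducibles X (eX : X -> tree) s :
  computable eX (encode_seq eword) s ->
  computable eX (encode_seq eword) (fun x => irreducibles (s x)).
Proof.
move=> cs; have cs1 := computable_weaken eword cs.
have cs2 := computable_weaken eword cs1.
apply: (@computable_filter _ _ _ _
  (fun x w => all (fun u => all (fun v => w != u ++ v) (s x)) (s x))) cs _.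
apply: (@computable_all _ _ _ _ (fun x u => all (fun v => x.2 != u ++ v) (s x.1))) cs1 _.
apply: (@computable_all _ _ _ _ (fun x v => x.1.2 != x.2 ++ v)) cs2 _.
set e := encode_pair _ _; have ci : computable e e id by exact: computable_id.
apply: computable_neg; apply: (@computable_eq _ _ _ eword).
- exact/encode_seq_inj/encode_letter_inj.
- exact: computable_snd (computable_fst (computable_fst ci)).
- exact: computable_cat (computable_snd (computable_fst ci)) (computable_snd ci).
Qed.

Lemma computable_equaliser_basis :
  computable (encode_seq (encode_seq eimage)) (encode_seq eword)
    (@equaliser_basis Sigma Delta).
Proof.
set eX := encode_seq _.
have ci : computable eX eX id by exact: computable_id.
apply: computable_irreducibles.
apply: (@computable_filter _ _ _ eword (fun ms w => (w != [::]) &&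
    all (fun m => all (fun m' => apply_table m w == apply_table m' w) ms) ms)).
  apply/computable_words_below/computable_succ.
  apply: (@computable_iter _ _ _ _ (fun _ => grow #|Sigma|)).
  - exact: computable_size ci.
  - apply: computable_succ; apply: computable_size.
    exact: computable_flatten (computable_flatten ci).
  - exact: computable_grow (computable_snd (@computable_id _ _)).
set e1 := encode_pair _ _; have c1 : computable e1 e1 id by exact: computable_id.
apply: computable_and.
  apply/computable_neg/(@computable_eq _ _ _ eword).
  - exact/encode_seq_inj/encode_letter_inj.
  - exact: computable_snd c1.
  - exact: computable_const.
apply: (@computable_all _ _ _ (encode_seq eimage)
  (fun p m => all (fun m' => apply_table m p.2 == apply_table m' p.2) p.1)).
  exact: computable_fst c1.
set e2 := encode_pair _ _; have c2 : computable e2 e2 id by exact: computable_id.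
apply: (@computable_all _ _ _ (encode_seq eimage)
  (fun p m' => apply_table p.2 p.1.2 == apply_table m' p.1.2)).
  exact: computable_fst (computable_fst c2).
set e3 := encode_pair _ _; have c3 : computable e3 e3 id by exact: computable_id.
have cw := computable_snd (computable_fst (computable_fst c3)).
apply: (@computable_eq _ _ _ eimage).
- exact/encode_seq_inj/encode_letter_inj.
- exact: computable_apply_table (computable_snd (computable_fst c3)) cw.
- exact: computable_apply_table (computable_snd c3) cw.
Qed.

End Computability.

(** * From letter maps to morphisms of free monoids *)

Section Bridge.
Variables Sigma Delta : finType.

Lemma ext_letter_images (f : seq Sigma -> seq Delta) w :
  Defs.monoid_morphism f -> ext (letter_images f) w = f w.
Proof.
move=> [f0 fM]; elim: w => // a w IHw.
by rewrite -cat1s fM -IHw.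
Qed.

Lemma letter_images_marked (f : seq Sigma -> seq Delta) :
  marked f -> marked_on [set: Sigma]%SET (letter_images f).
Proof.
move=> [_ f0 fI]; split=> [a _|a b _ _ e]; first exact: f0.
by apply: contrapT => /fI; apply.
Qed.

Lemma EqS_equalised (S : set (seq Sigma -> seq Delta)) :
  (forall f, S f -> Defs.monoid_morphism f) ->
  EqS S = equalised [set: Sigma]%SET (@letter_images _ _ @` S).
Proof.
move=> SM; apply/seteqP; split=> x /=.
  move=> xS; split; first by apply/allP => a; rewrite inE.
  move=> _ _ [f Sf <-] [g Sg <-].
  by rewrite !ext_letter_images; [exact: xS | exact: SM | exact: SM].
move=> [_ xS] f Sf g Sg; rewrite /Eq /=.
rewrite -(ext_letter_images x (SM f Sf)) -(ext_letter_images x (SM g Sg)).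
by apply: xS; [exists f | exists g].
Qed.

(** Atoms generate the equaliser and have distinct first letters, so listing them
without repetition, over any finite index type, yields a marked morphism onto
it. *)
Lemma basis_morphism (T : finType) (p : T -> seq Sigma) F :
  (forall f : Sigma -> seq Delta, F f -> marked_on [set: Sigma]%SET f) ->
  injective p -> (forall i, atom (equalised [set: Sigma]%SET F) (p i)) ->
  (forall x, atom (equalised [set: Sigma]%SET F) x -> exists i, x = p i) ->
  marked (ext p) /\ range (ext p) = equalised [set: Sigma]%SET F.
Proof.
move=> FM pI pA pP; have ext1 i : ext p [:: i] = p i by rewrite /ext /= cats0.
split.
  split=> [|i|i j ij]; first by split=> // x y; apply: ext_cat.
    by rewrite ext1; case: (pA i).
  by rewrite !ext1 => e; apply: ij; apply: pI; apply: atom_head_inj FM (pA i) (pA j) e.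
apply/seteqP; split=> [_ [y _ <-]|x xE].
  elim: y => [|i y IHy]; first by split.
  by apply: equalised_cat IHy; case: (pA i).
have [|y _ ->] := factor_ext (E := [set: T]%SET) (psi := p) _ xE; last by exists y.
by move=> y /pP[i ->]; exists i; rewrite ?inE.
Qed.

End Bridge.

Theorem theorem1 (Sigma Delta : finType) :
  (forall S : set (seq Sigma -> seq Delta),
     (forall f, S f -> marked f) ->
     exists (SigmaS : finType) (psi : seq SigmaS -> seq Sigma),
       marked psi /\ range psi = EqS S)
  /\
  (exists algorithm : cmd,
     forall fs : seq (seq Sigma -> seq Delta),
       (forall f, f \in fs -> marked f) ->
       exists (SigmaS : finType) (psi : seq SigmaS -> seq Sigma),
         [/\ computes algorithm (encode_morphisms fs) (encode_morphism psi),
             marked psi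
           & range psi = EqS [set f | f \in fs]]).
Proof.
split=> [S SM|].
  have FM g : (@letter_images _ _ @` S) g -> marked_on [set: Sigma]%SET g.
    by move=> [f /SM fM <-]; apply: letter_images_marked.
  have [E [psi [psiM psiA psiP]]] := equalised_basis FM.
  pose T : finType := {a | a \in E}.
  exists T, (ext (fun i : T => psi (val i))).
  rewrite EqS_equalised => [|f /SM[] //]; apply: basis_morphism => //.
  - move=> i j e; apply/val_inj/psiM.2; rewrite ?(valP i) ?(valP j) //.
    by rewrite e.
  - by move=> i; apply: psiA; exact: valP.
  - by move=> x /psiP[a aE ->]; exists (exist _ a aE).
have [c cP] := computable_computes (computable_equaliser_basis Sigma Delta).
exists c => fs fsM.
pose gs := map (@letter_images _ _) fs.
pose ws := equaliser_basis Sigma (map (@table _ _) gs).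
pose p (i : 'I_(size ws)) := nth [::] ws i.
have gsM g : g \in gs -> marked_on [set: Sigma]%SET g.
  by move=> /mapP[f /fsM fM ->]; apply: letter_images_marked.
have gsE : @letter_images Sigma Delta @` [set f | f \in fs] = [set g | g \in gs].
  apply/seteqP; split=> [_ [f ffs <-]|_ /mapP[f ffs ->]]; last by exists f.
  exact: map_f.
exists 'I_(size ws), (ext p).
have [pM pE] : marked (ext p) /\ range (ext p) = EqS [set f | f \in fs].
  rewrite EqS_equalised => [|f /fsM[] //]; rewrite gsE; apply: basis_morphism => //.
  - move=> i j /eqP; rewrite nth_uniq ?equaliser_basis_uniq // => /eqP.
    exact: val_inj.
  - by move=> i; apply/(mem_equaliser_basis _ gsM)/mem_nth.
  - move=> x /(mem_equaliser_basis _ gsM) xws.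
    have xi : index x ws < size ws by rewrite index_mem.
    by exists (Ordinal xi); rewrite /p /= nth_index.
split=> //.
have -> : encode_morphism (ext p) = encode_seq (@encode_word Sigma) ws.
  rewrite /encode_morphism; congr encode_seq.
  rewrite -[RHS](mkseq_nth [::]) /mkseq -val_enum_ord -map_comp.
  by apply: eq_map => i; rewrite /ext /= cats0.
have -> : encode_morphisms fs =
    encode_seq (encode_seq (@encode_word Delta)) (map (@table _ _) gs).
  by rewrite /encode_morphisms /gs -map_comp; elim: (fs) => //= f l ->.
exact: cP.
Qed.
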